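(* MinTimeline$_\infty$ can be solved in $O(2^{nk}n^2\tau)$ time, where $n=|V|$.
   Context: A temporal graph $\mathcal{G}=(V,(E_i)_{i\in[\tau]})$ consists of a finite vertex set $V$ and edge sets $E_1,\dots,E_\tau\subseteq\binom{V}{2}$. A $k$-activity timeline is a set $\mathcal{T}\subseteq\{(v,a,b)\in V\times[\tau]\times[\tau]\mid a\le b\}$ with at most $k$ triples $(v,\cdot,\cdot)$ for each $v\in V$; it covers $\mathcal{G}$ if for every $t\in[\tau]$ and $\{u,v\}\in E_t$ there is $(u,a,b)\in\mathcal{T}$ or $(v,a,b)\in\mathcal{T}$ with $a\le t\le b$. MinTimeline$_\infty$: given $(\mathcal{G},k,\ell)$ with $k,\ell\in\mathbb{N}_0$, decide whether there is a $k$-activity timeline $\mathcal{T}$ covering $\mathcal{G}$ with $\max_{(v,a,b)\in\mathcal{T}}(b-a)\le\ell$. *)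

(* Defs.v *)
From mathcomp Require Import all_boot.
Set Implicit Arguments. Unset Strict Implicit. Unset Printing Implicit Defensive.

(* Vertex set V = 'I_n, time steps 1..tau (as natural numbers),        *)
(* E t : {set {set 'I_n}} is the edge set at time t (only t in [tau]   *)
(* is relevant); edges are 2-element subsets of V.                     *)

Definition temporal_wf (n tau : nat) (E : nat -> {set {set 'I_n}}) : Prop :=
  forall t, forall e, e \in E t -> #|e| = 2.

(* A triple (v,a,b) of V x [tau] x [tau]; a,b are stored in 'I_tau.+1
   and the conditions 1 <= a <= b are part of being a valid timeline. *)
Definition triple n tau := ('I_n * 'I_tau.+1 * 'I_tau.+1)%type.

Definition k_activity_timeline n tau (k : nat) (T : {set triple n tau}) : Prop :=
  (forall x, x \in T -> 1 <= (x.1.2 : nat) <= x.2) /\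
  (forall v : 'I_n, #|[set x in T | x.1.1 == v]| <= k).

Definition covers n tau (E : nat -> {set {set 'I_n}}) (T : {set triple n tau}) : Prop :=
  forall t, 1 <= t <= tau -> forall e, e \in E t ->
    exists2 x, x \in T & [/\ x.1.1 \in e, (x.1.2 : nat) <= t & t <= x.2].

Definition MinTimeline_inf n tau (E : nat -> {set {set 'I_n}}) (k l : nat) : Prop :=
  exists T : {set triple n tau},
    [/\ k_activity_timeline k T, covers E T &
        forall x, x \in T -> (x.2 : nat) - x.1.2 <= l].

(* Model of computation: unit-cost RAM with addition, truncated        *)
(* subtraction, constants, indirect addressing and conditional jumps.  *)

Inductive instr : Type :=
  | IConst of nat & nat
  | IAdd of nat & nat & nat
  | ISub of nat & nat & nat
  | ILoad of nat & nat
  | IStore of nat & nat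
  | IJz of nat & nat
  | IJmp of nat
  | IHalt.

Definition program := seq instr.
Definition memory := nat -> nat.
Definition config := (nat * memory)%type.

Definition upd (m : memory) (r v : nat) : memory :=
  fun x => if x == r then v else m x.

Definition halted (p : program) (c : config) : bool :=
  if nth IHalt p c.1 is IHalt then true else false.

Definition step (p : program) (c : config) : config :=
  let: (pc, m) := c in
  match nth IHalt p pc with
  | IConst r v => (pc.+1, upd m r v)
  | IAdd r a b => (pc.+1, upd m r (m a + m b))
  | ISub r a b => (pc.+1, upd m r (m a - m b))
  | ILoad r a => (pc.+1, upd m r (m (m a)))
  | IStore a r => (pc.+1, upd m (m a) (m r))
  | IJz r j => (if m r == 0 then j else pc.+1, m)
  | IJmp j => (j, m)
  | IHalt => (pc, m)
  end.

(* Running [p] on initial memory [m0] halts after exactly [s] steps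
   (i.e. within s steps; s is the first halting time or later)
   with output [out] in register 0. *)
Definition halts_in (p : program) (m0 : memory) (s out : nat) : Prop :=
  let c := iter s (step p) (0, m0) in halted p c /\ c.2 0 = out.

(* Standard input encoding of an instance (adjacency-matrix style):
   address 0: n, 1: tau, 2: k, 3: l, and for t < tau, u < n, v < n,
   address 4 + t*n*n + u*n + v holds 1 iff {u,v} is an edge at time
   t+1 (u <> v); every other address holds 0. *)
Definition encode n tau (E : nat -> {set {set 'I_n}}) (k l : nat) : memory :=
  fun x =>
    if x == 0 then n else if x == 1 then tau else
    if x == 2 then k else if x == 3 then l else
    let y := x - 4 in
    let t := y %/ (n * n) in
    let u := (y %% (n * n)) %/ n in
    let v := (y %% (n * n)) %% n in
    if (t < tau) && (u < n) && (v < n) then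
      (if insub u is Some u' then
         if insub v is Some v' then
           ((u' != v') && ([set u'; v'] \in E t.+1) : nat)
         else 0
       else 0)
    else 0.

(* Main.v *)
Require Import Defs.
From mathcomp Require Import all_boot.
From mathcomp Require Import zify.
Set Implicit Arguments. Unset Strict Implicit. Unset Printing Implicit Defensive.

(* Scan the edges by increasing time.  An edge uncovered at time t forces one of its
   two ends to be active at t, and one may assume that this interval starts at t and
   has full length l; so the search branches in two and uses up one of the at most nk
   intervals.  A branch is thus described by nk bits: the program tries all numbers
   y < 2^(nk), each of which drives one greedy scan of the n^2 tau matrix entries, the
   bits of y telling which end is chosen.  On the RAM, the input occupies the low
   addresses; since its entries are bits, the first few cells are packed into one
   number to obtain free registers, and the input is then moved to higher addresses. *)

(** * Structured programs and their running time *)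

(** The obstacle on the machine side is memory: registers are fixed addresses, any fixed address
    from 4 on may hold an entry of a large matrix, and the four parameters must survive. So no
    register is free at the start, and far addresses can be reached only through a pointer kept in a
    register. A number [y] below [M = 2 ^ (n * k)] is read as the binary fraction [y / M]; doubling
    it and comparing with [M] extracts one digit without division or shifts. Multiplication is
    missing too, so products and powers come from counted loops of additions; computing [M] costs
    time linear in [n * k], which the factor [2 ^ (n * k)] absorbs. Machine code and combinatorics
    are kept apart: loops are shown to compute pure functions on an abstract [state], and only these
    are compared with the search [coverable]. *)

Inductive cmd : Type :=
  | Block of seq instr
  | Seq of cmd & cmd
  | If of nat & cmd & cmd
  | While of nat & cmd.

Infix ";;" := Seq (at level 60, right associativity).

Fixpoint csize (c : cmd) : nat :=
  match c with
  | Block l => size l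
  | Seq c1 c2 => csize c1 + csize c2
  | If _ c0 c1 => (csize c1 + csize c0).+2
  | While _ c => (csize c).+2
  end.

(* [If r c0 c1] runs [c0] when register [r] is zero; [While r c] loops while it is not. *)
Fixpoint compile (off : nat) (c : cmd) : program :=
  match c with
  | Block l => l
  | Seq c1 c2 => compile off c1 ++ compile (off + csize c1) c2
  | If r c0 c1 =>
      IJz r (off + csize c1).+2 :: compile off.+1 c1 ++
      IJmp (off + csize c1 + csize c0).+2 :: compile (off + csize c1).+2 c0
  | While r c => IJz r (off + csize c).+2 :: compile off.+1 c ++ [:: IJmp off]
  end.

Lemma size_compile c off : size (compile off c) = csize c.
Proof.
elim: c off => //= [c1 IH1 c2 IH2|r c0 IH0 c1 IH1|r c IH] off.
- by rewrite size_cat IH1 IH2.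
- by rewrite size_cat /= IH0 IH1 addnS.
- by rewrite size_cat /= IH addn1.
Qed.

(** No [IHalt] is emitted: the program counter runs off the end, where the default of [nth] is
    [IHalt]. *)
Lemma halted_compile c m : halted (compile 0 c) (csize c, m).
Proof. by rewrite /halted /= nth_default ?size_compile. Qed.

Definition straight (i : instr) : bool :=
  match i with IJz _ _ | IJmp _ | IHalt => false | _ => true end.

Definition effect (m : memory) (i : instr) : memory :=
  match i with
  | IConst r v => upd m r v
  | IAdd r a b => upd m r (m a + m b)
  | ISub r a b => upd m r (m a - m b)
  | ILoad r a => upd m r (m (m a))
  | IStore a r => upd m (m a) (m r)
  | _ => m
  end.

Definition code_at (p : program) (off : nat) (s : program) : Prop :=
  forall i, i < size s -> nth IHalt p (off + i) = nth IHalt s i.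

Lemma code_at_cat p off s1 s2 :
  code_at p off (s1 ++ s2) -> code_at p off s1 /\ code_at p (off + size s1) s2.
Proof.
move=> H; split=> i Hi.
- by rewrite H ?nth_cat ?Hi // size_cat ltn_addr.
- rewrite -addnA H ?size_cat ?ltn_add2l // nth_cat.
  by rewrite ltnNge leq_addr /= addKn.
Qed.

Lemma code_at_cons p off i s :
  code_at p off (i :: s) -> nth IHalt p off = i /\ code_at p off.+1 s.
Proof.
rewrite -[i :: s]/([:: i] ++ s) => /code_at_cat[H1 H2]; split.
  by have := H1 0 isT; rewrite addn0.
by move: H2; rewrite /= addn1.
Qed.

(* Total correctness from the memory [m], within [t] machine steps. *)
Definition hoare (c : cmd) (m : memory) (t : nat) (Q : memory -> Prop) : Prop :=
  forall p off, code_at p off (compile off c) ->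
    exists s m', [/\ s <= t, iter s (step p) (off, m) = (off + csize c, m') & Q m'].

Lemma hoare_le c m t t' (Q : memory -> Prop) :
  hoare c m t Q -> t <= t' -> hoare c m t' Q.
Proof.
move=> H le p off /H[s [m' [le1 E Hq]]]; exists s, m'; split=> //.
exact: leq_trans le.
Qed.

Lemma hoare_post c m t (Q Q' : memory -> Prop) :
  (forall m', Q m' -> Q' m') -> hoare c m t Q -> hoare c m t Q'.
Proof. by move=> QQ H p off /H[s [m' [? ? /QQ ?]]]; exists s, m'. Qed.

Lemma hoare_block l m (Q : memory -> Prop) :
  all straight l -> Q (foldl effect m l) -> hoare (Block l) m (size l) Q.
Proof.
elim: l m => [|i l IH] m /= => [_|/andP[si sl]] Hq p off Hc.
  by exists 0, m; rewrite /= addn0.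
have [E Hl] := code_at_cons Hc.
have [s [m' [le Es Hm']]] := IH _ sl Hq p off.+1 Hl.
exists s.+1, m'; split=> //.
rewrite iterSr.
have -> : step p (off, m) = (off.+1, effect m i).
  by rewrite /step E; case: (i) si.
by rewrite Es /= addSnnS.
Qed.

(** The postcondition of [c1] is itself a triple for [c2], so code can be executed symbolically
    without stating intermediate assertions. *)
Lemma hoare_seq c1 c2 m t1 t2 (Q : memory -> Prop) :
  hoare c1 m t1 (fun m1 => hoare c2 m1 t2 Q) -> hoare (c1 ;; c2) m (t1 + t2) Q.
Proof.
move=> H p off /= /code_at_cat[C1 C2].
have [s1 [m1 [le1 E1 H2]]] := H p off C1.
rewrite size_compile in C2.
have [s2 [m2 [le2 E2 H3]]] := H2 p _ C2.
exists (s2 + s1), m2; split=> //; first by rewrite addnC leq_add.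
by rewrite iterD E1 E2 addnA.
Qed.

Lemma hoare_if r c0 c1 m t (Q : memory -> Prop) :
  (m r = 0 -> hoare c0 m t Q) -> (0 < m r -> hoare c1 m t Q) ->
  hoare (If r c0 c1) m t.+2 Q.
Proof.
move=> H0 H1 p off /= /code_at_cons[E /code_at_cat[C1 /code_at_cons[E' C2]]].
case: (posnP (m r)) => Hr.
  rewrite size_compile addSnnS addnS in C2.
  have [s [m' [le Es Hm']]] := H0 Hr p _ C2.
  exists s.+1, m'; split=> //; first exact: ltnW.
  by rewrite iterSr {2}/step E Hr eqxx Es; congr (_, _); lia.
have [s [m' [le Es Hm']]] := H1 Hr p _ C1.
exists s.+2, m'; split=> //.
rewrite iterS iterSr {3}/step E eqn0Ngt Hr /= Es.
by rewrite size_compile in E'; rewrite /step E'; congr (_, _); lia.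
Qed.

(** [P] is indexed by the number of rounds left, which gives termination. Each round pays for the
    test and the jump back; the last test adds one. *)
Lemma hoare_while r c (P : nat -> memory -> Prop) t N m :
  (forall i m, P i.+1 m -> 0 < m r /\ hoare c m t (P i)) ->
  (forall m, P 0 m -> m r = 0) -> P N m ->
  hoare (While r c) m (N * t.+2).+1 (P 0).
Proof.
move=> HS H0; elim: N m => [|N IH] m HP p off /= C;
  have [E /code_at_cat[C1 /code_at_cons[E' _]]] := code_at_cons C.
  exists 1, m; split=> //=.
  by rewrite E H0 // eqxx !addnS.
have [Hr Hc] := HS _ _ HP.
have [s1 [m1 [le1 E1 P1]]] := Hc p _ C1.
have [s2 [m2 [le2 E2 P2]]] := IH _ P1 p _ C.
exists (s2 + s1.+2), m2; split=> //; first by lia.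
rewrite iterD iterS iterSr {4}/step E eqn0Ngt Hr /= E1.
by rewrite size_compile in E'; rewrite {2}/step E' E2.
Qed.

(** * The greedy scan as a program *)

(* Registers are fixed addresses.  Addresses 4 to 21 overlap the input edge data,
   so they are usable only once [pack] has saved their contents in [rY]. *)
Notation rN := 0 (only parsing).
Notation rTau := 1 (only parsing).
Notation rK := 2 (only parsing).
Notation rL := 3 (only parsing).
Notation rY := 4 (only parsing).
Notation rOne := 5 (only parsing).
Notation rM := 6 (only parsing).
Notation rD := 7 (only parsing).
Notation rC := 8 (only parsing).
Notation rA := 9 (only parsing).
Notation rX := 10 (only parsing).
Notation rT := 11 (only parsing).
Notation rU := 12 (only parsing).
Notation rV := 13 (only parsing).
Notation rE := 14 (only parsing).
Notation rOk := 15 (only parsing).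
Notation rRes := 16 (only parsing).
Notation rZero := 17 (only parsing).
Notation rS := 18 (only parsing).
Notation rQ := 19 (only parsing).
Notation rP := 20 (only parsing).
Notation rW := 21 (only parsing).
Notation nreg := 22 (only parsing).

(* A countdown loop; it relies on register [rOne] holding 1. *)
Definition For (r : nat) (c : cmd) : cmd := While r (c ;; Block [:: ISub r r rOne]).

(** [i] counts upwards while [r] holds [N - i]. The invariant may mention [r], so the body must
    establish it for the memory after the decrement, [upd m' r (N - i.+1)]. *)
Lemma hoare_for (S : Type) (f : nat -> S -> S) (Inv : nat -> S -> memory -> Prop)
    (r : nat) c N t s0 m :
  (forall i s m, i < N -> m r = N - i -> Inv i s m ->
     hoare c m t (fun m' => [/\ m' r = N - i, m' rOne = 1 &
                                Inv i.+1 (f i s) (upd m' r (N - i.+1))])) ->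
  m r = N -> Inv 0 s0 m ->
  hoare (For r c) m (N * t.+3).+1 (fun m' => m' r = 0 /\ Inv N (iteri N f s0) m').
Proof.
move=> H Hr H0.
pose P j m := [/\ j <= N, m r = j & Inv (N - j) (iteri (N - j) f s0) m].
have PN : P N m by rewrite /P subnn.
have := @hoare_while r (c ;; Block [:: ISub r r rOne]) P t.+1 N m.
move=> /(_ _ _ PN) HW; apply: hoare_post (HW _ _) => [m'|j m1|m1].
- by rewrite /P subn0 => -[].
- case=> le1 E1 I1; split; first by rewrite E1.
  rewrite -[t.+1]addn1; apply: hoare_seq.
  have lt1 : N - j.+1 < N by lia.
  apply: hoare_post (H _ _ _ lt1 _ I1) => [m2|]; last by rewrite E1 subKn.
  rewrite subKn // => -[E2 one2 I2].
  apply: (@hoare_block [:: ISub r r rOne]) => //=.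
  rewrite E2 one2 subn1 /=; split; [exact: ltnW|by rewrite /upd eqxx|].
  have E : (N - j.+1).+1 = N - j by lia.
  by move: I2; rewrite E subKn ?(ltnW le1) // -E.
- by case.
Qed.

(** Expects the array offset of the chosen vertex in [rQ] and the current time in [rW]. *)
Definition charge : cmd :=
  Block [:: IAdd rP rC rQ; ILoad rS rP] ;;
  If rS (Block [:: IConst rOk 0])
        (Block [:: ISub rS rS rOne; IStore rP rS; IAdd rP rD rQ;
                   IAdd rW rW rL; IAdd rW rW rOne; IStore rP rW]).

(** Truncated subtraction serves as comparison: [rS] is 0 exactly when [M <= y]. *)
Definition choose : cmd :=
  Block [:: IAdd rY rY rY; ISub rS rM rY] ;;
  If rS (Block [:: ISub rY rY rM; IAdd rQ rV rZero]) (Block [:: IAdd rQ rU rZero]).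

(** [rW] recovers the time from the countdown [rT]. The sum of the two truncated differences is 0
    exactly when neither end is active any more. *)
Definition scan_step : cmd :=
  Block [:: ILoad rS rE; IAdd rE rE rOne] ;;
  If rS (Block [::])
   (Block [:: IAdd rP rD rU; ILoad rS rP; IAdd rP rD rV; ILoad rQ rP;
              ISub rW rTau rT; ISub rS rS rW; ISub rQ rQ rW; IAdd rS rS rQ] ;;
    If rS (choose ;; charge) (Block [::])).

(* [expiry s v] is the first time (counted from 0) at which [v] is no longer active,
   [bits s] the unread choices; [good s] becomes 0 once a budget is overrun. *)
Record state := State
  { expiry : nat -> nat; budget : nat -> nat; bits : nat; good : nat }.

(* The next choice is the leading binary digit of the fraction [bits s / M]. *)
Definition greedy_step (M l : nat) (ed : nat -> nat -> nat -> bool) (t u v : nat)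
    (s : state) : state :=
  if [&& ed t u v, expiry s u <= t & expiry s v <= t] then
    let y := bits s + bits s in
    let w := if M <= y then v else u in
    let y' := if M <= y then y - M else y in
    if budget s w == 0 then State (expiry s) (budget s) y' 0
    else State (upd (expiry s) w (t + l).+1) (upd (budget s) w (budget s w).-1) y' (good s)
  else s.

(** The loops follow the order of the matrix in memory, so the pointer [rE] only ever advances by
    one. *)
Definition scan M l ed n tau s0 :=
  iteri tau (fun t => iteri n (fun u => iteri n (greedy_step M l ed t u))) s0.

Lemma iota18 : iota 0 18 = [:: 0; 1; 2; 3; 4; 5; 6; 7; 8; 9; 10; 11; 12; 13; 14; 15; 16; 17].
Proof. by []. Qed.

Lemma data_lt n tau t u v : t < tau -> u < n -> v < n ->
  t * (n * n) + u * n + v < tau * (n * n).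
Proof. nia. Qed.

Section Scan.
Variables (n tau k l M A D C : nat) (ed : nat -> nat -> nat -> bool).
(** Memory layout: registers below [nreg], the matrix from [A] up to [D], expiries in [D + 1] to
    [D + n], budgets in [C + 1] to [C + n]. *)
Hypotheses (hA : nreg <= A) (hD : A + tau * (n * n) <= D) (hC : C = D + n).

Definition data (m : memory) : Prop :=
  forall t u v, t < tau -> u < n -> v < n ->
    m (A + (t * (n * n) + u * n + v)) = ed t u v.

(* The entries of vertex [u] sit at offset [n - u] of the arrays, because the
   countdown registers [rU] and [rV] then serve directly as array indices. *)
Definition Inv (X T U V e res : nat) (s : state) (m : memory) : Prop :=
  [/\ [seq m i | i <- iota 0 18] =
       [:: n; tau; k; l; bits s; 1; M; D; C; A; X; T; U; V; A + e; good s; res; 0],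
      data m,
      forall u, u < n -> m (D + (n - u)) = expiry s u &
      forall u, u < n -> m (C + (n - u)) = budget s u].

Lemma charge_stepP t w X T U V e res s m : w < n -> m rQ = n - w -> m rW = t ->
  Inv X T U V e res s m ->
  hoare charge m 10 (Inv X T U V e res
    (if budget s w == 0 then State (expiry s) (budget s) (bits s) 0
     else State (upd (expiry s) w (t + l).+1) (upd (budget s) w (budget s w).-1)
            (bits s) (good s))).
Proof.
move=> Hw EQ EW [Hreg Hdata Hd Hc].
have := Hreg; rewrite iota18 /=.
move=> -[E0 E1 E2 E3 E4 E5 E6 E7 E8 E9 E10 E11 E12 E13 E14 E15 E16 E17].
pose EE := (E0, E1, E2, E3, E4, E5, E6, E7, E8, E9, E10, E11, E12, E13, E14, E15, E16,
  E17, EQ, EW).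
have nA a r : r < nreg -> (A + a == r) = false by lia.
have nD a r : r < nreg -> (D + a == r) = false by lia.
have nC a r : r < nreg -> (C + a == r) = false by lia.
(* The time is left open here; the rules accumulate it, and the last goal compares the total with
   the stated bound. The same pattern recurs below. *)
apply: hoare_le; first apply: hoare_seq; first apply: hoare_block => //.
  rewrite /= /upd /= !EE !nC // Hc //.
  apply: (@hoare_if _ _ _ _ 6) => /= Hb.
    apply: (@hoare_le _ _ 1) => //; apply: hoare_block => //=.
    rewrite /upd Hb eqxx; split => //=; first by rewrite !EE.
    - by move=> t' u' v' *; rewrite /= !nA //; apply: Hdata.
    - by move=> *; rewrite /= !nD //; apply: Hd.
    - by move=> *; rewrite /= !nC //; apply: Hc.
  apply: hoare_block => //=.
  have nC' a r : r < nreg -> (r == C + a) = false by lia.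
  have nD' a r : r < nreg -> (r == D + a) = false by lia.
  rewrite /upd /= !EE /= eqn0Ngt Hb /= !nC' //.
  split => /=; rewrite ?nD' //.
  - by rewrite !nC' // !EE.
  - move=> t' u' v' Ht' Hu' Hv'; have := data_lt Ht' Hu' Hv' => Hlt /=.
    have -> : (A + (t' * (n * n) + u' * n + v') == D + (n - w)) = false by lia.
    have -> : (A + (t' * (n * n) + u' * n + v') == C + (n - w)) = false by lia.
    by rewrite !nA //; apply: Hdata.
  - move=> u' Hu'.
    have -> : (D + (n - u') == C + (n - w)) = false by lia.
    have -> : (D + (n - u') == D + (n - w)) = (u' == w) by lia.
    by rewrite !nD // Hd // addn1.
  - move=> u' Hu'.
    have -> : (C + (n - u') == C + (n - w)) = (u' == w) by lia.
    have -> : (C + (n - u') == D + (n - w)) = false by lia.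
    by rewrite !nC // Hc // subn1.
by [].
Qed.

Lemma choose_stepP t u v X T e res s m : m rW = t ->
  Inv X T (n - u) (n - v) e res s m ->
  let y := bits s + bits s in
  hoare choose m 7 (fun m' => [/\ m' rQ = n - (if M <= y then v else u), m' rW = t &
    Inv X T (n - u) (n - v) e res
      (State (expiry s) (budget s) (if M <= y then y - M else y) (good s)) m']).
Proof.
move=> EW [Hreg Hdata Hd Hc] y.
have := Hreg; rewrite iota18 /=.
move=> -[E0 E1 E2 E3 E4 E5 E6 E7 E8 E9 E10 E11 E12 E13 E14 E15 E16 E17].
pose EE := (E0, E1, E2, E3, E4, E5, E6, E7, E8, E9, E10, E11, E12, E13, E14, E15, E16,
  E17, EW).
have nA a r : r < nreg -> (A + a == r) = false by lia.
have nD a r : r < nreg -> (D + a == r) = false by lia.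
have nC a r : r < nreg -> (C + a == r) = false by lia.
apply: hoare_le; first apply: hoare_seq; first apply: hoare_block => //.
  rewrite /= /upd /= !EE -/y.
  apply: (@hoare_if _ _ _ _ 2) => /= Hb; last apply: (@hoare_le _ _ 1) => //;
    apply: hoare_block => //=; rewrite /upd /= !EE /= ?addn0.
    have -> : M <= y by lia.
    split=> //; split => //=; first by rewrite !EE.
    - by move=> t' u' v' *; rewrite /= !nA //; apply: Hdata.
    - by move=> *; rewrite /= !nD //; apply: Hd.
    - by move=> *; rewrite /= !nC //; apply: Hc.
  have -> : (M <= y) = false by lia.
  split=> //; split => //=; first by rewrite !EE.
  - by move=> t' u' v' *; rewrite /= !nA //; apply: Hdata.
  - by move=> *; rewrite /= !nD //; apply: Hd.
  - by move=> *; rewrite /= !nC //; apply: Hc.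
by [].
Qed.

Lemma scan_stepP t u v X res s m : t < tau -> u < n -> v < n ->
  Inv X (tau - t) (n - u) (n - v) (t * (n * n) + u * n + v) res s m ->
  hoare scan_step m 40 (fun m' => m' rV = n - v /\ m' rOne = 1 /\
     Inv X (tau - t) (n - u) (n - v) (t * (n * n) + u * n + v.+1) res
       (greedy_step M l ed t u v s) m').
Proof.
move=> Ht Hu Hv [Hreg Hdata Hd Hc].
have := Hreg; rewrite iota18 /=.
move=> -[E0 E1 E2 E3 E4 E5 E6 E7 E8 E9 E10 E11 E12 E13 E14 E15 E16 E17].
pose EE := (E0, E1, E2, E3, E4, E5, E6, E7, E8, E9, E10, E11, E12, E13, E14, E15, E16, E17).
have nA a r : r < nreg -> (A + a == r) = false by lia.
have nD a r : r < nreg -> (D + a == r) = false by lia.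
have nC a r : r < nreg -> (C + a == r) = false by lia.
apply: hoare_le.
  apply: hoare_seq; apply: hoare_block => //.
  rewrite /= /upd /= !EE Hdata //.
  apply: hoare_if => /=.
    move=> /eqP; rewrite eqb0 => /negbTE Hed.
    apply: (@hoare_le _ _ 0 30) => //; apply: hoare_block => //=.
    rewrite !EE /greedy_step Hed /=; do !split => //.
    - by rewrite iota18 /= !EE addn1 -!addnS.
    - by move=> t' u' v' *; rewrite !nA //; apply: Hdata.
    - by move=> *; rewrite !nD //; apply: Hd.
    - by move=> *; rewrite !nC //; apply: Hc.
  rewrite lt0b => Hed.
  apply: (@hoare_le _ _ _ 30); first apply: hoare_seq; first apply: hoare_block => //=.
    rewrite /upd /= !EE !nD // ?Hd // subKn; last exact: ltnW.
    apply: hoare_if => /=.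
      set m1 := (X in hoare _ X) => Hcov.
      have I1 : Inv X (tau - t) (n - u) (n - v) (t * (n * n) + u * n + v).+1 res s m1.
        rewrite /m1; split => //=; first by rewrite !EE addn1 -!addnS.
        - by move=> t' u' v' *; rewrite /= !nA //; apply: Hdata.
        - by move=> *; rewrite /= !nD //; apply: Hd.
        - by move=> *; rewrite /= !nC //; apply: Hc.
      have W1 : m1 rW = t by [].
      apply: (@hoare_le _ _ 17); last exact: leqnn.
      apply: (@hoare_seq _ _ _ 7 10).
      apply: hoare_post (choose_stepP W1 I1) => m2 [Q2 W2 I2].
      have Hw : (if M <= bits s + bits s then v else u) < n by case: ifP.
      apply: hoare_post (charge_stepP Hw Q2 W2 I2) => m3 /=.
      rewrite /greedy_step Hed.
      have -> /= : (expiry s u <= t) && (expiry s v <= t) by lia.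
      rewrite addnS => I3; split; last by split=> //; case: I3; rewrite iota18; case.
      by case: I3; rewrite iota18; case.
    move=> Hcov; apply: (@hoare_le _ _ 0) => //; apply: hoare_block => //=.
    rewrite /greedy_step Hed.
    have -> : (expiry s u <= t) && (expiry s v <= t) = false by lia.
    do !split => //.
    - by rewrite iota18 /= !EE addn1 -!addnS.
    - by move=> t' u' v' *; rewrite !nA //; apply: Hdata.
    - by move=> *; rewrite !nD //; apply: Hd.
    - by move=> *; rewrite !nC //; apply: Hc.
  by [].
by [].
Qed.
End Scan.

(** * Nested loops: the whole scan, one attempt, all attempts *)

Definition scan_row : cmd := Block [:: IAdd rV rN rZero] ;; For rV scan_step.
Definition scan_time : cmd := Block [:: IAdd rU rN rZero] ;; For rU scan_row.
Definition scan_all : cmd := Block [:: IAdd rE rA rZero; IAdd rT rTau rZero] ;; For rT scan_time.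

Definition init_step : cmd :=
  Block [:: IAdd rP rD rU; IStore rP rZero; IAdd rP rC rU; IStore rP rK].

(** [rX] runs from [M] down to 1, so the candidates [rX - 1] are exactly the numbers below [M]. *)
Definition attempt : cmd :=
  Block [:: ISub rY rX rOne; IConst rOk 1; IAdd rU rN rZero] ;;
  For rU init_step ;; scan_all ;;
  If rOk (Block [::]) (Block [:: IConst rRes 1]).

Definition start (k y : nat) : state := State (fun _ => 0) (fun _ => k) y 1.

Section Attempt.
Variables (n tau k l M A D C : nat) (ed : nat -> nat -> nat -> bool).
Hypotheses (hA : nreg <= A) (hD : A + tau * (n * n) <= D) (hC : C = D + n).

Local Notation Inv := (Inv n tau k l M A D C ed).

(** A change confined to registers leaves matrix and arrays alone, so only the register list has to
    be checked again. *)
Lemma Inv_frame X T U V e res s X' T' U' V' e' res' y g m m' :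
  Inv X T U V e res s m -> (forall x, nreg <= x -> m' x = m x) ->
  [seq m' i | i <- iota 0 18] =
    [:: n; tau; k; l; y; 1; M; D; C; A; X'; T'; U'; V'; A + e'; g; res'; 0] ->
  Inv X' T' U' V' e' res' (State (expiry s) (budget s) y g) m'.
Proof.
move=> [_ Hdata Hd Hc] Hm Hr; split=> //.
- by move=> t u v *; rewrite Hm; [apply: Hdata|lia].
- by move=> u *; rewrite Hm; [apply: Hd|lia].
- by move=> u *; rewrite Hm; [apply: Hc|lia].
Qed.

(** Memory determines [expiry] and [budget] only below [n]; this allows replacing the outcome of the
    initialization loop by [start], with which it agrees there. *)
Lemma Inv_ext X T U V e res s s' m : Inv X T U V e res s m ->
  (forall u, u < n -> expiry s u = expiry s' u) ->
  (forall u, u < n -> budget s u = budget s' u) ->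
  bits s = bits s' -> good s = good s' -> Inv X T U V e res s' m.
Proof.
move=> [Hr Hdata Hd Hc] H1 H2 H3 H4; split=> //; first by rewrite Hr H3 H4.
- by move=> u Hu; rewrite Hd ?H1.
- by move=> u Hu; rewrite Hc ?H2.
Qed.

Ltac regs I :=
  move: (I) => [];
  rewrite iota18 /= => -[? ? ? ? ? ? ? ? ? ? ? ? ? ? ? ? ? ?] _ _ _.

Ltac frame I :=
  apply: Inv_frame I _ _;
  [ by move=> ? ?; rewrite /= /upd; repeat case: eqP => [?|_]; try lia
  | rewrite iota18 /= /upd /=; repeat (congr (_ :: _); try lia) ].

(** A round costs 40 steps for [scan_step] and 3 for decrement, test and jump; the 2 pays for
    setting the counter and for the exit test. *)
Lemma scan_rowP t u X V res s m : t < tau -> u < n ->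
  Inv X (tau - t) (n - u) V (t * (n * n) + u * n) res s m ->
  hoare scan_row m (43 * n + 2) (fun m' => [/\ m' rU = n - u, m' rOne = 1 &
    Inv X (tau - t) (n - u) 0 (t * (n * n) + u.+1 * n) res
       (iteri n (greedy_step M l ed t u) s) m']).
Proof.
move=> Ht Hu I; apply: hoare_le.
  apply: hoare_seq; apply: hoare_block => //=.
  pose J i s m := Inv X (tau - t) (n - u) (n - i) (t * (n * n) + u * n + i) res s m.
  apply: hoare_post; last first.
    apply: (@hoare_for _ (greedy_step M l ed t u) J rV scan_step n 40 s).
    - move=> i s1 m1 Hi _ I1.
      apply: hoare_post (scan_stepP hA hD hC Ht Hu Hi I1) => m2 [H1 [H2 I2]].
      split=> //; rewrite /J.
      case: (s1) (greedy_step _ _ _ _ _ _ _) I2 => ? ? ? ? [? ? y g] I2.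
      regs I2. frame I2.
    - regs I; rewrite /upd /=; lia.
    - rewrite /J subn0 addn0; case: (s) I => ? ? ? ? I; regs I; frame I.
  move=> m1 [_]; rewrite /J subnn => I1.
  have -> : t * (n * n) + u.+1 * n = t * (n * n) + u * n + n by lia.
  split=> //; by regs I1.
rewrite /=; lia.
Qed.

Lemma scan_timeP t X U V res s m : t < tau ->
  Inv X (tau - t) U V (t * (n * n)) res s m ->
  hoare scan_time m ((43 * n + 5) * n + 2) (fun m' => [/\ m' rT = tau - t, m' rOne = 1 &
    exists V', Inv X (tau - t) 0 V' (t.+1 * (n * n)) res
       (iteri n (fun u => iteri n (greedy_step M l ed t u)) s) m']).
Proof.
move=> Ht I; apply: hoare_le.
  apply: hoare_seq; apply: hoare_block => //=.
  pose J i s m := exists V', Inv X (tau - t) (n - i) V' (t * (n * n) + i * n) res s m.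
  apply: hoare_post; last first.
    apply: (@hoare_for _ (fun u => iteri n (greedy_step M l ed t u)) J rU scan_row n
      (43 * n + 2) s).
    - move=> i s1 m1 Hi _ [V1 I1].
      apply: hoare_post (scan_rowP Ht Hi I1) => m2 [H1 H2 I2].
      split=> //; exists 0; case: (iteri _ _ _) I2 => ? ? y g I2.
      regs I2. frame I2.
    - regs I; rewrite /upd /=; lia.
    - exists V; rewrite subn0 addn0; case: (s) I => ? ? ? ? I; regs I; frame I.
  move=> m1 [_ [V1]]; rewrite subnn => I1.
  have -> : t.+1 * (n * n) = t * (n * n) + n * n by lia.
  split; [by regs I1| by regs I1|by exists V1].
rewrite /=; lia.
Qed.

Lemma scan_allP X T U V e res s m :
  Inv X T U V e res s m ->
  hoare scan_all m (((43 * n + 5) * n + 5) * tau + 3) (fun m' =>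
    exists U V e, Inv X 0 U V e res (scan M l ed n tau s) m').
Proof.
move=> I; apply: hoare_le.
  apply: hoare_seq; apply: hoare_block => //=.
  pose J i s m := exists U' V', Inv X (tau - i) U' V' (i * (n * n)) res s m.
  apply: hoare_post; last first.
    apply: (@hoare_for _ (fun t => iteri n (fun u => iteri n (greedy_step M l ed t u))) J rT
       scan_time tau ((43 * n + 5) * n + 2) s).
    - move=> i s1 m1 Hi _ [U1 [V1 I1]].
      apply: hoare_post (scan_timeP Hi I1) => m2 [H1 H2 [V2 I2]].
      split=> //; exists 0, V2; case: (iteri _ _ _) I2 => ? ? y g I2.
      regs I2. frame I2.
    - regs I; rewrite /upd /=; lia.
    - exists U, V; rewrite subn0; case: (s) I => ? ? ? ? I; regs I; frame I.
  move=> m1 [_ [U1 [V1]]]; rewrite subnn => I1.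
  by exists U1, V1, (tau * (n * n)).
rewrite /=; lia.
Qed.

Definition reset i s := State (upd (expiry s) i 0) (upd (budget s) i k) (bits s) (good s).

Lemma init_stepP i X T V e res s m : i < n -> Inv X T (n - i) V e res s m ->
  hoare init_step m 4 (fun m' => [/\ m' rU = n - i, m' rOne = 1 &
     Inv X T (n - i.+1) V e res (reset i s) (upd m' rU (n - i.+1))]).
Proof.
move=> Hi I; move: (I) => [_ Hdata Hd Hc].
regs I.
apply: hoare_block => //=.
have nA a r : r < nreg -> (A + a == r) = false by lia.
have nD a r : r < nreg -> (D + a == r) = false by lia.
have nC a r : r < nreg -> (C + a == r) = false by lia.
have nC' a r : r < nreg -> (r == C + a) = false by lia.
have nD' a r : r < nreg -> (r == D + a) = false by lia.
have EE : (m 7 = D) * (m 12 = n - i) * (m 17 = 0) * (m 8 = C) * (m 2 = k) * (m 5 = 1) by [].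
rewrite /upd /= !EE /= !nD' //= !nC' //=; split=> //; split=> /=.
- rewrite !nC' // !nD' //=; repeat (congr (_ :: _); try lia).
- move=> t' u' v' Ht' Hu' Hv' /=; have := data_lt Ht' Hu' Hv' => Hlt.
  have -> : (A + (t' * (n * n) + u' * n + v') == D + (n - i)) = false by lia.
  have -> : (A + (t' * (n * n) + u' * n + v') == C + (n - i)) = false by lia.
  by rewrite !nA //; apply: Hdata.
- move=> u' Hu'.
  have -> : (D + (n - u') == C + (n - i)) = false by lia.
  have -> : (D + (n - u') == D + (n - i)) = (u' == i) by lia.
  by rewrite !nD // Hd.
- move=> u' Hu'.
  have -> : (C + (n - u') == C + (n - i)) = (u' == i) by lia.
  have -> : (C + (n - u') == D + (n - i)) = false by lia.
  by rewrite !nC // Hc.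
Qed.

Lemma reset_iter i s : i <= n ->
  [/\ forall u, u < i -> expiry (iteri i reset s) u = 0,
      forall u, u < i -> budget (iteri i reset s) u = k,
      bits (iteri i reset s) = bits s & good (iteri i reset s) = good s].
Proof.
elim: i => [|i IH] Hi //=; have [H1 H2 H3 H4] := IH (ltnW Hi).
split=> // u Hu; rewrite /upd; case: eqP => // ?; [apply: H1|apply: H2]; lia.
Qed.

(** The final state is hidden behind an existential, since the next attempt resets arrays, digits
    and flag; only the result register carries over. *)
Lemma attemptP X T U V e res s m :
  Inv X T U V e res s m ->
  hoare attempt m (((43 * n + 5) * n + 5) * tau + 7 * n + 11) (fun m' =>
    [/\ m' rX = X, m' rOne = 1 & exists U V e s',
      Inv X 0 U V e (if good (scan M l ed n tau (start k X.-1)) == 0 then res else 1) s' m']).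
Proof.
move=> I; apply: hoare_le.
  apply: hoare_seq; apply: hoare_block => //=.
  apply: hoare_seq.
  pose J i s m := Inv X T (n - i) V e res s m.
  apply: hoare_post; last first.
    apply: (@hoare_for _ reset J rU init_step n 4 (State (expiry s) (budget s) X.-1 1)).
    - by move=> i s1 m1 Hi _ I1; apply: init_stepP.
    - regs I; rewrite /upd /=; lia.
    - rewrite /J subn0; case: (s) I => ? ? ? ? I; regs I; frame I.
  move=> m1 [_]; rewrite /J subnn => I1.
  have [H1 H2 H3 H4] := @reset_iter n (State (expiry s) (budget s) X.-1 1) (leqnn n).
  have {}I1 := @Inv_ext _ _ _ _ _ _ _ (start k X.-1) _ I1 H1 H2 H3 H4.
  apply: hoare_seq.
  apply: hoare_post (scan_allP I1) => m2 [U2 [V2 [e2 I2]]].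
  apply: (@hoare_if _ _ _ _ 1).
    have -> : m2 rOk = good (scan M l ed n tau (start k X.-1)) by regs I2.
    move=> ->; apply: (@hoare_le _ _ 0) => //; apply: hoare_block => //=.
    by split; [regs I2|regs I2|exists U2, V2, e2, (scan M l ed n tau (start k X.-1))].
  have -> : m2 rOk = good (scan M l ed n tau (start k X.-1)) by regs I2.
  rewrite lt0n => /negbTE->; apply: hoare_block => //=.
  split; [by regs I2|by regs I2|exists U2, V2, e2].
  eexists; regs I2; frame I2; by [].
rewrite /=; lia.
Qed.

Definition hit i res :=
  if good (scan M l ed n tau (start k (M - i).-1)) == 0 then res else 1.

Lemma attemptsP T U V e s m :
  Inv M T U V e 0 s m ->
  hoare (For rX attempt) m (M * (((43 * n + 5) * n + 5) * tau + 7 * n + 14)).+1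
    (fun m' => m' rRes = iteri M hit 0).
Proof.
move=> I; pose J i res m := exists T U V e s, Inv (M - i) T U V e res s m.
apply: hoare_post; last first.
  apply: hoare_le; first apply: (@hoare_for _ hit J rX attempt M
      (((43 * n + 5) * n + 5) * tau + 7 * n + 11) 0).
  - move=> i res m1 Hi _ [T1 [U1 [V1 [e1 [s1 I1]]]]].
    apply: hoare_post (attemptP I1) => m2 [H1 H2 [U2 [V2 [e2 [s2 I2]]]]].
    split=> //; rewrite /J; exists 0, U2, V2, e2; eexists.
    regs I2; frame I2; by [].
  - by regs I.
  - by exists T, U, V, e, s; rewrite subn0.
  lia.
by move=> m1 [_ [T1 [U1 [V1 [e1 [s1 I1]]]]]]; regs I1.
Qed.
End Attempt.

(** * Freeing the registers and setting up memory *)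

(** Most significant digit first: packing doubles and adds, unpacking takes off the leading
    digit. *)
Fixpoint binval (q : nat) (f : nat -> nat) : nat :=
  if q is q'.+1 then f 0 * 2 ^ q' + binval q' (fun j => f j.+1) else 0.

Lemma eq_binval q f g : f =1 g -> binval q f = binval q g.
Proof.
elim: q f g => //= q IH f g E; rewrite E; congr (_ + _).
by apply: IH => j; rewrite E.
Qed.

Lemma binval_lt q f : (forall j, f j <= 1) -> binval q f < 2 ^ q.
Proof.
elim: q f => //= q IH f H; have := IH (fun j => f j.+1) (fun j => H j.+1).
by rewrite expnS; have := H 0; nia.
Qed.

(* On [q + i + 1] binary digits, doubling shifts the leading digit [b] out. *)
Lemma double_step q i b x : b <= 1 -> x < 2 ^ q ->
  let y := (b * 2 ^ q + x) * 2 ^ i + (b * 2 ^ q + x) * 2 ^ i in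
  (2 ^ (q + i).+1 <= y) = (b == 1) /\
  (if b == 1 then y - 2 ^ (q + i).+1 else y) = x * 2 ^ i.+1.
Proof.
move=> Hb Hx /=; rewrite !expnS expnD.
have : 0 < 2 ^ i by rewrite expn_gt0.
case: b Hb => [|[|b]] // _ Hi; rewrite /=; split; nia.
Qed.

(* Uses no register besides [rY], hence can run before any register is free. *)
Definition pack (a q : nat) : cmd :=
  Block (flatten [seq [:: IAdd rY rY rY; IAdd rY rY j] | j <- iota a q]).

Lemma packP a q m : rY < a ->
  hoare (pack a q) m (q + q) (fun m' =>
    m' rY = m rY * 2 ^ q + binval q (fun j => m (a + j)) /\
    forall x, x != rY -> m' x = m x).
Proof.
move=> Ha; apply: hoare_le; first apply: hoare_block.
- by elim: q a {Ha} => //= q IH a.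
- elim: q a m Ha => [|q IH] a m Ha /=; first by rewrite muln1 addn0.
  set m1 := upd _ _ _.
  have [E1 E2] := IH a.+1 m1 (ltnW Ha).
  have F x : x != rY -> m1 x = m x by move=> /negbTE Hx; rewrite /m1 /upd Hx.
  split=> [|x Hx]; last by rewrite E2 // F.
  rewrite E1 (@eq_binval _ _ (fun j => m (a + j.+1))); last by move=> j; rewrite F; [congr m|]; lia.
  have -> : m1 rY = m rY + m rY + m a.
    by rewrite /m1 /upd /=; case: eqP Ha => // ->.
  rewrite addn0 expnS; lia.
- by elim: q a {Ha} => //= q IH a; have := IH a.+1; rewrite -/(iota _ _); lia.
Qed.

(** Multiplication by repeated addition, at 4 steps a round. *)
Lemma sum_loopP rc a b m :
  m rOne = 1 -> uniq [:: rOne; rc; a; b] ->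
  hoare (For rc (Block [:: IAdd a a b])) m (4 * m rc + 1) (fun m' =>
    [/\ m' a = m a + m rc * m b, m' rc = 0 &
        forall x, x \notin [:: rc; a] -> m' x = m x]).
Proof.
rewrite /= !inE !negb_or => H1 /and4P[/and3P[n1 n2 n3] /andP[n4 n5] n6 _].
pose J i (_ : unit) m' := m' a = m a + i * m b /\ forall x, x \notin [:: rc; a] -> m' x = m x.
apply: hoare_le.
  apply: hoare_post; last first.
    apply: (@hoare_for _ (fun _ => id) J rc _ (m rc) 1 tt) => //.
    + move=> i [] m1 Hi Hr [E1 E2].
      apply: hoare_block => //=; rewrite /J /upd.
      rewrite !eqxx (negbTE n4) (negbTE n2) eq_sym (negbTE n4) Hr; split=> //.
        by rewrite E2 // !inE negb_or n1 n2.
      split; first by rewrite E1 E2 ?mulSn; [lia|rewrite !inE negb_or eq_sym n5 eq_sym n6].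
      by move=> x Hx; move: (Hx); rewrite !inE negb_or => /andP[/negbTE-> /negbTE->]; apply: E2.
    + by split=> //; rewrite mul0n addn0.
  by move=> m' [? [? ?]].
lia.
Qed.

Lemma power_loopP rc a m :
  m rOne = 1 -> uniq [:: rOne; rc; a] ->
  hoare (For rc (Block [:: IAdd a a a])) m (4 * m rc + 1) (fun m' =>
    [/\ m' a = m a * 2 ^ m rc, m' rc = 0 &
        forall x, x \notin [:: rc; a] -> m' x = m x]).
Proof.
rewrite /= !inE !negb_or => H1 /and3P[/andP[n1 n2] n4 _].
pose J i (_ : unit) m' := m' a = m a * 2 ^ i /\ forall x, x \notin [:: rc; a] -> m' x = m x.
apply: hoare_le.
  apply: hoare_post; last first.
    apply: (@hoare_for _ (fun _ => id) J rc _ (m rc) 1 tt) => //.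
    + move=> i [] m1 Hi Hr [E1 E2].
      apply: hoare_block => //=; rewrite /J /upd.
      rewrite !eqxx (negbTE n4) (negbTE n2) eq_sym (negbTE n4) Hr; split=> //.
        by rewrite E2 // !inE negb_or n1 n2.
      split; first by rewrite E1 expnS; lia.
      by move=> x Hx; move: (Hx); rewrite !inE negb_or => /andP[/negbTE-> /negbTE->]; apply: E2.
    + by split=> //; rewrite muln1.
  by move=> m' [? [? ?]].
lia.
Qed.

Definition unpack_step : cmd :=
  Block [:: IAdd rY rY rY; ISub rS rM rY] ;;
  If rS (Block [:: ISub rY rY rM; IStore rE rOne]) (Block [:: IStore rE rZero]) ;;
  Block [:: IAdd rE rE rOne].

(** After [i] rounds [rY] holds the remaining [q - i] digits shifted left by [i] places, so the next
    digit is again the leading one of [q], and [double_step] applies. *)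
Lemma unpackP q A f m : nreg <= A -> (forall j, f j <= 1) ->
  m rY = binval q f -> m rM = 2 ^ q -> m rOne = 1 -> m rZero = 0 -> m rX = q -> m rE = A ->
  hoare (For rX unpack_step) m (11 * q + 1) (fun m' =>
   [/\ m' rE = A + q, forall j, j < q -> m' (A + j) = f j &
       forall x, x < A -> x \notin [:: rX; rY; rS; rE] -> m' x = m x]).
Proof.
move=> HA Hf HY HM HO HZ HX HE.
pose J i (_ : unit) m' :=
   [/\ m' rY = binval (q - i) (fun j => f (i + j)) * 2 ^ i, m' rE = A + i,
       forall j, j < i -> m' (A + j) = f j &
       forall x, x < A -> x \notin [:: rX; rY; rS; rE] -> m' x = m x].
have nA a r : r < nreg -> (A + a == r) = false by lia.
have nA' a r : r < nreg -> (r == A + a) = false by lia.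
apply: hoare_le.
  apply: hoare_post; last first.
    apply: (@hoare_for _ (fun _ => id) J rX unpack_step q 8 tt) => //.
    + move=> i [] m1 Hi Hr [E1 E2 E3 E4].
      have E5 : (m1 rM = 2 ^ q) * (m1 rOne = 1) * (m1 rZero = 0).
        by rewrite !E4 //=; lia.
      have Hq : q - i = (q - i.+1).+1 by lia.
      have B : forall j, (fun j => f (i.+1 + j)) j <= 1 by move=> j; apply: Hf.
      have := double_step i (Hf i) (binval_lt (q - i.+1) B).
      have -> : (q - i.+1 + i).+1 = q by lia.
      have E : binval (q - i) (fun j => f (i + j)) =
               f i * 2 ^ (q - i.+1) + binval (q - i.+1) (fun j => f (i.+1 + j)).
        by rewrite Hq /= addn0; congr (_ + _); apply: eq_binval => j; rewrite addnS.
      rewrite -E -E1 => /= -[D1 D2].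
      apply: (@hoare_le _ _ (2 + (4 + 1))) => //.
      apply: hoare_seq; apply: hoare_block => //=; rewrite /upd /= !E5.
      apply: hoare_seq.
      apply: (@hoare_if _ _ _ _ 2) => /= Hs; [|apply: (@hoare_le _ _ 1) => //].
      * have Hfi : (f i == 1) by lia.
        apply: hoare_block => //=; apply: hoare_block => //=.
        rewrite /upd /= !E5 !E2 /= !nA' //=.
        split=> //.
        rewrite Hfi in D2; rewrite /J /= !nA' //= D2; split=> //.
        - by lia.
        - move=> j Hj; rewrite nA // nA //.
          case: eqP => [Ej|Ne]; first by (have -> : j = i by lia); rewrite (eqP Hfi).
          rewrite !nA //; apply: E3; lia.
        - move=> x Hx Hn; move: (Hn); rewrite !inE !negb_or.
          case/and4P=> /negbTE-> /negbTE-> /negbTE-> /negbTE->.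
          by have -> : (x == A + i) = false; [lia|apply: E4].
      * have Hfi : (f i == 1) = false by lia.
        apply: hoare_block => //=; apply: hoare_block => //=.
        rewrite /upd /= !E5 !E2 /= !nA' //=.
        split=> //.
        rewrite Hfi in D2; rewrite /J /= !nA' //= D2; split=> //.
        - by lia.
        - move=> j Hj; rewrite nA // nA //.
          case: eqP => [Ej|Ne]; first by (have -> : j = i by lia); have := Hf i; lia.
          rewrite !nA //; apply: E3; lia.
        - move=> x Hx Hn; move: (Hn); rewrite !inE !negb_or.
          case/and4P=> /negbTE-> /negbTE-> /negbTE-> /negbTE->.
          by have -> : (x == A + i) = false; [lia|apply: E4].
    + by split=> //; rewrite ?subn0 ?muln1 ?HY ?HE ?addn0 //; apply: eq_binval.
  by move=> m' [? [? ? ? ?]].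
lia.
Qed.

Definition copy_step : cmd :=
  Block [:: ILoad rS rV; IStore rE rS; IAdd rV rV rOne; IAdd rE rE rOne].

(** The source ends below the target, so no cell is overwritten before it is read. *)
Lemma copyP N src A B m : nreg <= A -> src + N <= A -> A <= B ->
  m rOne = 1 -> m rX = N -> m rV = src -> m rE = B -> nreg <= src ->
  hoare (For rX copy_step) m (7 * N + 1) (fun m' =>
   [/\ forall j, j < N -> m' (B + j) = m (src + j) &
       forall x, x < B -> x \notin [:: rX; rV; rS; rE] -> m' x = m x]).
Proof.
move=> HA HS HB HO HX HV HE Hsrc.
pose J i (_ : unit) m' :=
   [/\ m' rV = src + i, m' rE = B + i,
       forall j, j < i -> m' (B + j) = m (src + j) &
       forall x, x < B -> x \notin [:: rX; rV; rS; rE] -> m' x = m x].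
have nA a r : r < nreg -> (B + a == r) = false by lia.
have nA' a r : r < nreg -> (r == B + a) = false by lia.
apply: hoare_le.
  apply: hoare_post; last first.
    apply: (@hoare_for _ (fun _ => id) J rX copy_step N 4 tt) => //.
    + move=> i [] m1 Hi Hr [E1 E2 E3 E4].
      have EO : m1 rOne = 1 by rewrite E4 //=; lia.
      have ES : m1 (src + i) = m (src + i) by rewrite E4 //= ?inE; lia.
      apply: hoare_block => //=; rewrite /upd /= !E1 !E2 /= !nA' //= EO; split=> //.
      rewrite /J /= ?ES ?nA' //=; split.
      - by lia.
      - by lia.
      - move=> j Hj; have -> : (B + j == B + i) = (j == i) by lia.
        case: (eqVneq j i) => [->|Ne]; rewrite !nA //.
        apply: E3; lia.
      - move=> x Hx Hn; move: (Hn); rewrite !inE !negb_or.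
        case/and4P=> /negbTE-> /negbTE-> /negbTE-> /negbTE->.
        by have -> : (x == B + i) = false; [lia|apply: E4].
    + by split=> //; rewrite ?HV ?HE addn0.
  by move=> m' [? [? ? ? ?]].
lia.
Qed.

Arguments binval : simpl never.

(** [rY] is address 4 and already holds the first digit; with the 17 cells 5 to 21 this makes 18
    digits. The size of the matrix is computed as [n * (n * tau)], so that both loops run [n]
    rounds. *)
Definition allocate : cmd :=
  pack 5 17 ;;
  Block [:: IConst rOne 1; IConst rZero 0; IConst rS 0; IAdd rU rN rZero] ;;
  For rU (Block [:: IAdd rS rS rTau]) ;;
  Block [:: IConst rP 0; IAdd rU rN rZero] ;;
  For rU (Block [:: IAdd rP rP rS]) ;;
  Block [:: IConst rA nreg; IAdd rA rA rP; IConst rD nreg; IAdd rD rD rA; IAdd rD rD rP;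
            IAdd rC rD rN; IConst rM (2 ^ 18); IConst rX 18; IAdd rE rA rZero].

(** The first 18 entries come out of [rY], the others still sit at 22 and above. Copying [N] cells
    to [A + 18] overshoots the matrix by 18 cells, still below [D]. *)
Definition relocate : cmd :=
  For rX unpack_step ;;
  Block [:: IConst rV nreg; IAdd rX rP rZero] ;;
  For rX copy_step.

Definition prepare : cmd :=
  Block [:: IConst rQ 0; IAdd rU rN rZero] ;;
  For rU (Block [:: IAdd rQ rQ rK]) ;;
  Block [:: IConst rM 1] ;;
  For rQ (Block [:: IAdd rM rM rM]) ;;
  Block [:: IConst rRes 0; IAdd rX rM rZero; IAdd rE rA rZero].

Definition solver : cmd :=
  allocate ;; relocate ;; prepare ;; For rX attempt ;;
  Block [:: IConst rN 0; IAdd rN rN rRes].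

Section Solver.
Variables (n tau k l : nat) (ed : nat -> nat -> nat -> bool) (m0 : memory).
Hypotheses (h0 : m0 rN = n) (h1 : m0 rTau = tau) (h2 : m0 rK = k) (h3 : m0 rL = l).
Hypothesis hbit : forall x, m0 (4 + x) <= 1.
Hypothesis hed : forall t u v, t < tau -> u < n -> v < n ->
  m0 (4 + (t * (n * n) + u * n + v)) = ed t u v.

Let N := n * (n * tau).
Let A := nreg + N.
Let D := nreg + A + N.
Let C := D + n.

Definition params (m : memory) : Prop :=
  [seq m i | i <- [:: rN; rTau; rK; rL; rOne; rZero; rP; rA; rD; rC]] =
  [:: n; tau; k; l; 1; 0; N; A; D; C].

Lemma allocateP : hoare allocate m0 (8 * n + 60) (fun m =>
  [/\ params m, forall x, nreg <= x -> m x = m0 x,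
      m rY = binval 18 (fun j => m0 (4 + j)), m rM = 2 ^ 18 & m rX = 18 /\ m rE = A]).
Proof.
apply: hoare_le.
  apply: hoare_seq.
  apply: hoare_post (@packP 5 17 m0 isT) => m1 [Y1 F1].
  apply: hoare_seq; apply: hoare_block => //; set m2 := foldl _ _ _.
  have U2 : m2 rU = n by rewrite /m2 /= /upd /= !F1 // addn0 h0.
  have F2 : forall x, x < 5 -> m2 x = m1 x.
    by move=> x; rewrite /m2 /= /upd; do 5?[case: x => [//|x]].
  have F2' : forall x, nreg <= x -> m2 x = m1 x.
    by move=> x Hx; rewrite /m2 /= /upd; repeat case: eqP => [?|_]; try lia.
  apply: hoare_seq.
  apply: hoare_le.
    apply: hoare_post; last by apply: (@sum_loopP rU rS rTau m2).
    move=> m3 [S3 U3 F3].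
    apply: hoare_seq; apply: hoare_block => //; set m4 := foldl _ _ _.
    have U4 : m4 rU = n.
      by rewrite /m4 /= /upd /= !F3 // (F2 0) // F1 // h0 addn0.
    have S4 : m4 rS = n * tau.
      by rewrite /m4 /= /upd /= S3 U2 (F2 1) // F1 // h1 //.
    have F4 : forall x, x \notin [:: rP; rU] -> m4 x = m3 x.
      by move=> x; rewrite !inE /m4 /= /upd; case: (x == 20) => //; case: (x == 12).
    apply: hoare_seq.
    apply: hoare_le.
      apply: hoare_post; last first.
        apply: (@sum_loopP rU rP rS m4); [by rewrite F4 ?F3|by []].
      move=> m5 [P5 U5 F5].
      apply: hoare_block => //.
      have P5' : m5 rP = N by rewrite P5 U4 S4.
      have G5 : forall x, x < 5 -> m5 x = m1 x.
        move=> x Hx; rewrite F5 ?F4 ?F3 ?F2 // !inE; lia.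
      have GG : (m5 0 = n) * (m5 1 = tau) * (m5 2 = k) * (m5 3 = l) * (m5 5 = 1) *
          (m5 17 = 0) * (m5 4 = binval 18 (fun j => m0 (4 + j))).
        have [-> -> -> -> ->] : [/\ m5 0 = n, m5 1 = tau, m5 2 = k, m5 3 = l &
            m5 4 = binval 18 (fun j => m0 (4 + j))].
          by split; rewrite G5 // ?Y1 // F1.
        have [-> ->] // : m5 5 = 1 /\ m5 17 = 0.
        by split; rewrite F5 // F4 // F3.
      rewrite /params /= /upd /= !P5' !GG.
      rewrite !addn0; split=> //.
      - move=> x Hx; repeat (case: eqP => [?|_]; first lia).
        rewrite F5 ?F4 ?F3 ?F2' ?F1 // ?inE; lia.
    by rewrite U4; apply: leqnn.
  by rewrite U2; apply: leqnn.
by rewrite /=; lia.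
Qed.

Lemma relocateP m :
  [/\ params m, forall x, nreg <= x -> m x = m0 x,
      m rY = binval 18 (fun j => m0 (4 + j)), m rM = 2 ^ 18 & m rX = 18 /\ m rE = A] ->
  hoare relocate m (7 * N + 203) (fun m' =>
    params m' /\ forall j, j < N -> m' (A + j) = m0 (4 + j)).
Proof.
case=> Hp Hh HY HM [HX HE].
have := Hp => -[E0 E1 E2 E3 E5 E17 E20 E9 E7 E8].
have HA : nreg <= A by rewrite /A; lia.
apply: hoare_le.
  apply: hoare_seq.
  apply: hoare_post (unpackP HA hbit HY HM E5 E17 HX HE) => m1 [R1 B1 F1].
  have G1 x : x < nreg -> x \notin [:: rX; rY; rS; rE] -> m1 x = m x.
    by move=> Hx; apply: F1; lia.
  apply: hoare_seq; apply: hoare_block => //=.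
  rewrite /upd /= !G1 // E20 E17 addn0; set m2 := (X in hoare _ X).
  have F2 x : x \notin [:: rX; rV] -> m2 x = m1 x.
    by rewrite !inE /m2; case: (x == 10) => //; case: (x == 13).
  have O2 : m2 rOne = 1 by rewrite F2 // G1.
  have E2' : m2 rE = A + 18 by rewrite F2.
  apply: hoare_post; last first.
    exact: (@copyP N nreg A (A + 18) m2 HA (leqnn _) (leq_addr _ _) O2 _ _ E2').
  move=> m3 [B3 F3].
  have G3 x : x < nreg -> x \notin [:: rX; rV; rS; rE; rY] -> m3 x = m x.
    move=> Hx Hn; rewrite F3 ?F2 ?G1 //; move: Hn; rewrite ?inE; lia.
  split; first by rewrite /params -Hp /= !G3.
  move=> j Hj; case: (ltnP j 18) => Hj'.
    rewrite F3 ?F2 ?B1 // ?inE; lia.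
  have -> : A + j = A + 18 + (j - 18) by lia.
  rewrite B3 ?F2 ?F1; [|rewrite /A ?inE; lia..].
  rewrite Hh; last by lia.
  congr m0; lia.
by rewrite /=; lia.
Qed.

Lemma prepareP m : params m /\ (forall j, j < N -> m (A + j) = m0 (4 + j)) ->
  hoare prepare m (4 * n + 4 * (n * k) + 8) (fun m' =>
    exists T U V e s, Inv n tau k l (2 ^ (n * k)) A D C ed (2 ^ (n * k)) T U V e 0 s m').
Proof.
case=> Hp Hh.
have := Hp => -[E0 E1 E2 E3 E5 E17 E20 E9 E7 E8].
apply: hoare_le.
  apply: hoare_seq; apply: hoare_block => //; set m1 := foldl _ _ _.
  have F1 x : x \notin [:: rQ; rU] -> m1 x = m x.
    by rewrite !inE /m1 /= /upd; case: (x == 19) => //; case: (x == 12).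
  have U1 : m1 rU = n by rewrite /m1 /= /upd /= E0 E17 addn0.
  have Q1 : m1 rQ = 0 by [].
  apply: hoare_seq; apply: hoare_le.
    apply: hoare_post; last first.
      apply: (@sum_loopP rU rQ rK m1) => //.
    move=> m2 [Q2 U2 F2].
    have {}Q2 : m2 rQ = n * k by rewrite Q2 U1 Q1 F1 // E2.
    apply: hoare_seq; apply: hoare_block => //; set m3 := foldl _ _ _.
    have F3 x : x != rM -> m3 x = m2 x by move=> /negbTE H; rewrite /m3 /= /upd H.
    have M3 : m3 rM = 1 by [].
    apply: hoare_seq; apply: hoare_le.
      apply: hoare_post; last first.
        by apply: (@power_loopP rQ rM m3) => //; rewrite F3 // F2 // F1.
      move=> m4 [M4 Q4 F4].
      have {}M4 : m4 rM = 2 ^ (n * k) by rewrite M4 M3 mul1n F3 // Q2.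
      have F x : x \notin [:: rM; rQ; rU] -> m4 x = m x.
        rewrite !inE => H; rewrite F4 ?F3 ?F2 ?F1 ?inE //; lia.
      apply: hoare_block => //; set m5 := foldl _ _ _.
      have F5 x : x \notin [:: rM; rQ; rU; rRes; rX; rE] -> m5 x = m x.
        rewrite !inE => H; rewrite -F ?inE; last by lia.
        rewrite /m5 /= /upd; move: H.
        case: (x == 14); [lia|]; case: (x == 10); [lia|]; case: (x == 16); lia.
      have X5 : m5 rX = 2 ^ (n * k).
        by rewrite /m5 /= /upd /= M4 F // E17 addn0.
      have E14 : m5 rE = A by rewrite /m5 /= /upd /= !F // E17 E9 addn0.
      have [R0 R1 R2 R3] : [/\ m5 rN = n, m5 rTau = tau, m5 rK = k & m5 rL = l].
        by split; rewrite F5.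
      have [R5 R17 R9 R7] : [/\ m5 rOne = 1, m5 rZero = 0, m5 rA = A & m5 rD = D].
        by split; rewrite F5.
      have [R8 R6 R16] : [/\ m5 rC = C, m5 rM = 2 ^ (n * k) & m5 rRes = 0].
        by split; [rewrite F5| |].
      (* The arrays hold arbitrary values at this point; the initial state merely records them, as
         each attempt resets them. *)
      exists (m5 rT), (m5 rU), (m5 rV), 0,
        (State (fun u => m5 (D + (n - u))) (fun u => m5 (C + (n - u))) (m5 rY) (m5 rOk)).
      split=> //.
      - by rewrite iota18 /= R0 R1 R2 R3 R5 R6 R7 R8 R9 R16 R17 X5 addn0 E14.
      - move=> t u v Ht Hu Hv; have := data_lt Ht Hu Hv => Hlt.
        rewrite F5; last by rewrite /A !inE; lia.
        by rewrite Hh ?hed //; rewrite /N; lia.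
    rewrite F3 // Q2; exact: leqnn.
  by rewrite U1; apply: leqnn.
by rewrite /=; lia.
Qed.

Lemma solverP : 0 < n -> 0 < tau ->
  hoare solver m0 (1000 * (2 ^ (n * k) * n ^ 2 * tau)) (fun m =>
    m 0 = iteri (2 ^ (n * k)) (hit n tau k l (2 ^ (n * k)) ed) 0).
Proof.
move=> Hn Htau.
apply: hoare_le.
  apply: hoare_seq; apply: hoare_post allocateP => m1 /relocateP H1.
  apply: hoare_seq; apply: hoare_post H1 => m2 /prepareP H2.
  apply: hoare_seq; apply: hoare_post H2 => m3 [T [U [V [e [s I3]]]]].
  have HA : nreg <= A by rewrite /A; lia.
  have HD : A + tau * (n * n) <= D by rewrite /D /N; lia.
  apply: hoare_seq; apply: hoare_post (attemptsP HA HD (erefl C) I3) => m4 H4.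
  by apply: hoare_block.
(* Absorbs the [4 * (n * k)] steps spent on computing the power. *)
have HP : n * k < 2 ^ (n * k) by apply: ltn_expl.
move: HP; set P := 2 ^ (n * k); rewrite /N /= => HP.
have -> : P * n ^ 2 * tau = P * (n * (n * tau)) by rewrite !expnS; lia.
set q := n * (n * tau).
have q1 : n <= q by rewrite /q; nia.
have q2 : n * tau <= q by rewrite /q; nia.
have q3 : tau <= q by nia.
have -> : ((43 * n + 5) * n + 5) * tau + 7 * n + 14 =
  43 * q + 5 * (n * tau) + 5 * tau + 7 * n + 14 by rewrite /q; lia.
(* 74 = 43 + 5 + 5 + 7 + 14, every term being at most its coefficient times [q]. *)
have : P * (43 * q + 5 * (n * tau) + 5 * tau + 7 * n + 14) <= P * (74 * q).
  by rewrite leq_mul2l; apply/orP; right; lia.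
have : q <= P * q by rewrite leq_pmull //; lia.
have : P <= P * q by rewrite leq_pmulr //; lia.
move: HP; set a := P * q; set b := P * (43 * _ + _ + _ + _ + _).
have -> : P * (74 * q) = 74 * a by rewrite /a; lia.
lia.
Qed.
End Solver.

(** * Correctness of the greedy search *)

Definition pos := (nat * nat * nat)%type.

(** The three loops become a fold over one list, so that correctness can go by induction on the
    positions left. *)
Definition positions (n tau : nat) : seq pos :=
  flatten [seq flatten [seq [seq (t, u, v) | v <- iota 0 n] | u <- iota 0 n] | t <- iota 0 tau].

Lemma iteri_foldl (S : Type) n (f : nat -> S -> S) x :
  iteri n f x = foldl (fun s i => f i s) x (iota 0 n).
Proof.
elim: n => // n IH; have -> : iota 0 n.+1 = iota 0 n ++ [:: n] by rewrite -addn1 iotaD.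
by rewrite foldl_cat -IH.
Qed.

Lemma foldl_flatten (S I : Type) (f : S -> I -> S) x ss :
  foldl f x (flatten ss) = foldl (foldl f) x ss.
Proof. by elim: ss x => //= s ss IH x; rewrite foldl_cat IH. Qed.

Lemma foldl_map (S I J : Type) (f : S -> J -> S) (g : I -> J) x s :
  foldl f x [seq g i | i <- s] = foldl (fun y i => f y (g i)) x s.
Proof. by elim: s x => //= i s IH x; rewrite IH. Qed.

Lemma eq_foldl (S I : Type) (f g : S -> I -> S) x s : f =2 g -> foldl f x s = foldl g x s.
Proof. by move=> E; elim: s x => //= i s IH x; rewrite E IH. Qed.

Definition step_at M l ed (s : state) (p : pos) := greedy_step M l ed p.1.1 p.1.2 p.2 s.

Lemma scanE M l ed n tau s : scan M l ed n tau s = foldl (step_at M l ed) s (positions n tau).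
Proof.
rewrite /scan iteri_foldl foldl_flatten foldl_map; apply: eq_foldl => {}s t.
rewrite iteri_foldl foldl_flatten foldl_map; apply: eq_foldl => {}s u.
by rewrite iteri_foldl foldl_map.
Qed.

Lemma mem_positions n tau p :
  (p \in positions n tau) = [&& p.1.1 < tau, p.1.2 < n & p.2 < n].
Proof.
case: p => [[t u] v] /=; apply/flatten_mapP/and3P => [[t']|[Ht Hu Hv]].
  rewrite mem_iota => Ht /flatten_mapP[u']; rewrite mem_iota => Hu /mapP[v'].
  by rewrite mem_iota => Hv [-> -> ->].
exists t; rewrite ?mem_iota //; apply/flatten_mapP; exists u; rewrite ?mem_iota //.
by apply/mapP; exists v; rewrite ?mem_iota.
Qed.

Definition earlier (p q : pos) := p.1.1 <= q.1.1.

Lemma positions_sorted n tau : pairwise earlier (positions n tau).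
Proof.
rewrite /positions; suff: forall a, pairwise earlier (flatten
  [seq flatten [seq [seq (t, u, v) | v <- iota 0 n] | u <- iota 0 n] | t <- iota a tau]).
  exact.
elim: tau => //= tau IH a; rewrite pairwise_cat IH andbT.
have H (p : pos) t0 :
    p \in flatten [seq [seq (t0, u, v) | v <- iota 0 n] | u <- iota 0 n] -> p.1.1 = t0.
  by case/flatten_mapP => u _ /mapP[v _ ->].
apply/andP; split.
  apply/allrelP => p q /H Hp /flatten_mapP[t]; rewrite mem_iota => Ht /H Hq.
  by rewrite /earlier Hp Hq; lia.
apply/(pairwiseP (0, 0, 0)) => i j Hi Hj _.
by rewrite /earlier (H _ _ (mem_nth _ Hi)) (H _ _ (mem_nth _ Hj)).
Qed.

Section Greedy.
Variables (n tau l : nat) (ed : nat -> nat -> nat -> bool).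

(* The backtracking search: an uncovered edge is covered by starting, at that very
   time, an interval at one of its ends. *)
Fixpoint coverable (L : seq pos) (d c : nat -> nat) : bool :=
  if L is p :: L' then
    let t := p.1.1 in
    let use w := (0 < c w) && coverable L' (upd d w (t + l).+1) (upd c w (c w).-1) in
    if [&& ed t p.1.2 p.2, d p.1.2 <= t & d p.2 <= t] then use p.1.2 || use p.2
    else coverable L' d c
  else true.

Lemma scan_failed M L s : good s = 0 -> good (foldl (step_at M l ed) s L) = 0.
Proof.
elim: L s => //= p L IH s H; apply: IH; rewrite /step_at /greedy_step.
by case: ifP => // _; case: ifP.
Qed.

(** Each digit read selects one of the two branches, and a flag that stays nonzero certifies that
    every budget charged was positive. *)
Lemma scan_coverable M L s : good (foldl (step_at M l ed) s L) != 0 ->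
  coverable L (expiry s) (budget s).
Proof.
elim: L s => //= p L IH s; rewrite {2}/step_at /greedy_step.
case: ifP => // _; last exact: IH.
set b := M <= _; case: (budget s _ =P 0) => [_|/eqP Hb]; first by rewrite scan_failed.
by move=> /IH /=; move: Hb; rewrite -lt0n; case: b => -> ->; rewrite ?orbT.
Qed.

(** [S] is the total budget left. Every branching spends one unit and one digit, so of [K] digits
    [K - S] have been shifted out, whence the factor [2 ^ (K - S)]. *)
Lemma coverable_scan K L d (c : nat -> nat) S :
  all (fun p : pos => (p.1.2 < n) && (p.2 < n)) L ->
  \sum_(i < n) c i = S -> S <= K -> coverable L d c ->
  exists2 z, z < 2 ^ S &
    good (foldl (step_at (2 ^ K) l ed) (State d c (z * 2 ^ (K - S)) 1) L) = 1.
Proof.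
elim: L d c S => [|p L IH] d c S /=; first by exists 0; rewrite ?expn_gt0.
case/andP=> /andP[Hu Hv] HL HS HK; case: ifP => Hp; last first.
  by move=> /(IH _ _ _ HL HS HK)[z Hz Hg]; exists z => //; rewrite {2}/step_at /greedy_step /= Hp.
have main b : let w := if b then p.2 else p.1.2 in
  (0 < c w) && coverable L (upd d w (p.1.1 + l).+1) (upd c w (c w).-1) ->
  exists2 z, z < 2 ^ S & good (foldl (step_at (2 ^ K) l ed)
     (step_at (2 ^ K) l ed (State d c (z * 2 ^ (K - S)) 1) p) L) = 1.
  move=> w /andP[Hw Hc].
  have wn : w < n by rewrite /w; case: (b).
  have HS' : \sum_(i < n) upd c w (c w).-1 i = S.-1 /\ 0 < S.
    have : S = c w + \sum_(i < n | i != Ordinal wn) c i.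
      by rewrite -HS (bigD1 (Ordinal wn)).
    move=> ES; rewrite (bigD1 (Ordinal wn)) //= {1}/upd eqxx.
    have -> : \sum_(i < n | i != Ordinal wn) upd c w (c w).-1 i =
              \sum_(i < n | i != Ordinal wn) c i.
      by apply: eq_bigr => i; rewrite /upd -val_eqE /= => /negbTE->.
    lia.
  case: HS' => HS' S0.
  have [z Hz Hg] := IH _ _ _ HL HS' (leq_trans (leq_pred _) HK) Hc.
  have Hb1 : b <= 1 by case: (b).
  have [D1 D2] := double_step (K - S) Hb1 Hz.
  have EK : (S.-1 + (K - S)).+1 = K by lia.
  have EK' : (K - S).+1 = K - S.-1 by lia.
  rewrite EK EK' eqb1 in D1 D2.
  (* The present choice [b] becomes the leading digit in front of the later choices [z]. *)
  exists (b * 2 ^ S.-1 + z).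
    by rewrite -(prednK S0) expnS /=; move: Hb1 Hz; clear; nia.
  rewrite {2}/step_at /greedy_step Hp [bits _]/= D1 D2 -/w /=.
  by rewrite eqn0Ngt Hw.
by case/orP; [apply: (main false)|apply: (main true)].
Qed.

(** A residual problem: [d] summarizes the intervals already fixed, and [T] covers the rest within
    the budgets [c]. Positions count time from 0 and triples from 1, hence the successors. *)
Definition covering (L : seq pos) (d c : nat -> nat) (T : {set triple n tau}) : Prop :=
  [/\ forall x, x \in T -> 1 <= (x.1.2 : nat) <= x.2,
      forall v : 'I_n, #|[set x in T | x.1.1 == v]| <= c v,
      forall x, x \in T -> (x.2 : nat) - x.1.2 <= l &
      forall p : pos, p \in L -> ed p.1.1 p.1.2 p.2 ->
        p.1.1 < d p.1.2 \/ p.1.1 < d p.2 \/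
        exists2 x, x \in T & [/\ (x.1.1 : nat) \in [:: p.1.2; p.2],
           (x.1.2 : nat) <= p.1.1.+1 & p.1.1.+1 <= x.2]].

(* Exchange argument: the interval of [T] that covers the first uncovered edge, at time
   [t], ends by time [t + l]; on the times from [t] on it is thus contained in the
   interval of length [l] started at [t]. *)
Lemma coverableP L d c : pairwise earlier L -> {subset L <= positions n tau} ->
  coverable L d c <-> exists T, covering L d c T.
Proof.
elim: L d c => [|p L IH] d c.
  split=> // _; exists set0; split=> // [x|v|x]; rewrite ?inE //.
  by rewrite (_ : [set x in _ | _] = set0) ?cards0 //; apply/setP => x; rewrite !inE.
rewrite [pairwise _ _]/= => /andP[/allP Hle Hpw] Hsub.
have HsubL : {subset L <= positions n tau}.
  by move=> q Hq; apply: Hsub; rewrite inE Hq orbT.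
have := Hsub p (mem_head _ _); rewrite mem_positions => /and3P[pt pu pv].
rewrite [coverable _ _ _]/=; case: ifP => Hp; last first.
  rewrite IH //; split=> -[T [T1 T2 T3 T4]]; exists T; split=> //.
    move=> q; rewrite inE => /orP[/eqP->|]; last exact: T4.
    by move=> He; move: Hp; rewrite He /=; lia.
  by move=> q Hq; apply: T4; rewrite inE Hq orbT.
case/and3P: Hp => Hed Hdu Hdv.
split.
- have main w : w \in [:: p.1.2; p.2] ->
    (0 < c w) && coverable L (upd d w (p.1.1 + l).+1) (upd c w (c w).-1) ->
    exists T, covering (p :: L) d c T.
    move=> Hw /andP[cw] /IH[//|//|T [T1 T2 T3 T4]].
    have wn : w < n by move: Hw; rewrite !inE => /orP[]/eqP->.
    have an : p.1.1.+1 < tau.+1 by [].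
    (* The interval is cut off at [tau] to be a legal triple; no position lies later. *)
    have bn : minn (p.1.1.+1 + l) tau < tau.+1 by rewrite ltnS geq_minr.
    pose x0 : triple n tau := (Ordinal wn, Ordinal an, Ordinal bn).
    exists (x0 |: T); split.
    + by move=> x /setU1P[->|/T1] //=; lia.
    + move=> v; have := T2 v; rewrite /upd; case: eqP => Hv Hc.
        have Hs : [set x in x0 |: T | x.1.1 == v] \subset x0 |: [set x in T | x.1.1 == v].
          by apply/subsetP => x; rewrite !inE => /andP[/orP[->|->] ->] //; rewrite orbT.
        have := subset_leq_card Hs; rewrite cardsU1 => H.
        rewrite Hv; apply: leq_trans H _; rewrite -(prednK cw) -[_.-1.+1]add1n.
        by apply: leq_add => //; apply: leq_b1.
      apply: leq_trans Hc; apply: subset_leq_card; apply/subsetP => x.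
      rewrite !inE => /andP[/orP[/eqP->|->] //] /eqP E; case: Hv; by rewrite -E.
    + by move=> x /setU1P[->|/T3] //=; lia.
    + have Hx0 : x0 \in x0 |: T by rewrite setU11.
      move=> q; rewrite inE => /orP[/eqP->|Hq] He.
        right; right; exists x0 => //=; split=> //; lia.
      have Hqp : p.1.1 <= q.1.1 := Hle _ Hq.
      have := HsubL _ Hq; rewrite mem_positions => /and3P[qt _ _].
      (* Whatever the updated expiry of [w] accounts for is covered by [x0], because [q] is not
         earlier than [p]. *)
      have new : q.1.1 < (p.1.1 + l).+1 -> w \in [:: q.1.2; q.2] ->
         exists2 x, x \in x0 |: T & [/\ (x.1.1 : nat) \in [:: q.1.2; q.2],
           (x.1.2 : nat) <= q.1.1.+1 & q.1.1.+1 <= x.2].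
        by move=> H1 H2; exists x0 => //=; split=> //; rewrite leq_min qt andbT; lia.
      case: (T4 q Hq He) => [|[|[x xT Hx]]].
      * rewrite /upd; case: eqP => [E|_]; last by left.
        by move=> H; right; right; apply: new => //; rewrite E mem_head.
      * rewrite /upd; case: eqP => [E|_]; last by right; left.
        by move=> H; right; right; apply: new => //; rewrite E !inE eqxx orbT.
      * by right; right; exists x => //; rewrite inE xT orbT.
  by case/orP; apply: main; rewrite !inE eqxx ?orbT.
- case=> T [T1 T2 T3 T4].
  case: (T4 p (mem_head _ _) Hed) => [|[|[x xT [xw xa xb]]]]; [lia|lia|].
  have main : (0 < c x.1.1) &&
     coverable L (upd d x.1.1 (p.1.1 + l).+1) (upd c x.1.1 (c x.1.1).-1).
    have Hx : x \in [set y in T | y.1.1 == x.1.1] by rewrite inE xT eqxx.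
    have Hc := T2 x.1.1; rewrite (cardsD1 x) Hx in Hc.
    apply/andP; split; first by lia.
    apply/IH => //; exists (T :\ x); split.
    + by move=> y /setD1P[_ /T1].
    + move=> v; rewrite /upd; case: eqP => Hv.
        have Hv' : v = x.1.1 by apply: val_inj.
        rewrite Hv'.
        rewrite (_ : [set y in T :\ x | _] = [set y in T | y.1.1 == x.1.1] :\ x); first by lia.
        by apply/setP => y; rewrite !inE andbA.
      apply: leq_trans (T2 v); apply: subset_leq_card; apply/subsetP => y.
      by rewrite !inE => /andP[/andP[_ ->] ->].
    + by move=> y /setD1P[_ /T3].
    + move=> q Hq He.
      have Hqp : p.1.1 <= q.1.1 := Hle _ Hq.
      (* Overwriting the expiry of the chosen end loses nothing: it was at most the current time. *)
      have Hd v : q.1.1 < d v -> q.1.1 < upd d x.1.1 (p.1.1 + l).+1 v.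
        move: xw; rewrite /upd !inE; case: (v =P _) => [->|//].
        by move=> /orP[]/eqP->; lia.
      have HqL : q \in p :: L by rewrite inE Hq orbT.
      case: (T4 q HqL He) => [/Hd|[/Hd|[y yT [yw ya yb]]]]; [by left|by right; left|].
      case: (eqVneq y x) => [Ey|Ne]; last by right; right; exists y => //; rewrite inE yT andbT inE.
      have Hl := T3 x xT; rewrite Ey in yw ya yb.
      move: yw; rewrite !inE => /orP[]/eqP E; [left|right; left];
        by rewrite -E /upd eqxx; lia.
  by move: xw main; rewrite !inE => /orP[]/eqP->->; rewrite ?orbT.
Qed.

End Greedy.

(** * Input encoding and the main theorem *)

Definition edge_at n (E : nat -> {set {set 'I_n}}) (t u v : nat) : bool :=
  if insub u is Some u' then
    if insub v is Some v' then (u' != v') && ([set u'; v'] \in E t.+1) else false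
  else false.

Lemma encode_edge n tau (E : nat -> {set {set 'I_n}}) k l t u v :
  t < tau -> u < n -> v < n ->
  encode tau E k l (4 + (t * (n * n) + u * n + v)) = edge_at E t u v.
Proof.
move=> Ht Hu Hv; rewrite /encode /edge_at !addKn -!addnA.
set y := t * (n * n) + (u * n + v).
have n0 : 0 < n by apply: leq_ltn_trans Hu.
have Hlt : u * n + v < n * n by nia.
have -> : y %/ (n * n) = t by rewrite /y divnMDl ?muln_gt0 ?n0 // divn_small ?addn0.
have -> : y %% (n * n) = u * n + v by rewrite /y modnMDl modn_small.
have -> : (u * n + v) %/ n = u by rewrite divnMDl // divn_small // addn0.
have -> : (u * n + v) %% n = v by rewrite modnMDl modn_small.
rewrite Ht Hu Hv /=.
by case: insub => // u'; case: insub.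
Qed.

Lemma encode_bit n tau (E : nat -> {set {set 'I_n}}) k l x : encode tau E k l (4 + x) <= 1.
Proof.
by rewrite /encode /=; case: ifP => // _; do 2![case: insub => //= ?]; apply: leq_b1.
Qed.

Lemma edge_at_ord n (E : nat -> {set {set 'I_n}}) t (u v : 'I_n) :
  edge_at E t u v = (u != v) && ([set u; v] \in E t.+1).
Proof. by rewrite /edge_at !valK. Qed.

(** Expiry 0 everywhere means that nothing is covered yet. Since edges have two elements, each one
    appears as a position. *)
Lemma MinTimeline_covering n tau (E : nat -> {set {set 'I_n}}) k l :
  temporal_wf tau E ->
  MinTimeline_inf tau E k l <->
  exists T : {set triple n tau}, covering l (edge_at E) (positions n tau) (fun=> 0) (fun=> k) T.
Proof.
move=> wf; split=> -[T].
  case=> -[T1 T2] Hc T3; exists T; split=> // -[[t u] v].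
  rewrite mem_positions /= => /and3P[Ht Hu Hv] He; right; right.
  have := He; rewrite (edge_at_ord E t (Ordinal Hu) (Ordinal Hv)) => /andP[_ He'].
  have [|x xT [xe xa xb]] := Hc t.+1 _ _ He'; first by [].
  by exists x => //; split=> //; move: xe; rewrite !inE -!val_eqE.
case=> T1 T2 T3 T4; exists T; split=> // t /andP[t0 tT] e He.
have /eqP/cards2P[u [v [Huv Ee]]] := wf t e He.
case: t t0 tT He => // t _ tT He.
have Hp : (t, u : nat, v : nat) \in positions n tau by rewrite mem_positions /= tT !ltn_ord.
case: (T4 _ Hp) => [|//|[//|[x xT [xe xa xb]]]].
  by rewrite /= edge_at_ord Huv -Ee.
by exists x => //; split=> //; move: xe; rewrite Ee !inE -!val_eqE.
Qed.

Lemma MinTimeline_trivial n tau (E : nat -> {set {set 'I_n}}) k l :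
  temporal_wf tau E -> n = 0 \/ tau = 0 -> MinTimeline_inf tau E k l.
Proof.
move=> wf H; exists set0; split=> [|t Ht e He|x]; last by rewrite inE.
  split=> [x|v]; rewrite ?inE //.
  by rewrite (_ : [set x in _ | _] = set0) ?cards0 //; apply/setP => x; rewrite !inE.
case: H => [n0|]; last by lia.
suff n2 : 1 < n by exfalso; lia.
by rewrite -(wf _ _ He) (leq_trans (max_card _)) ?card_ord.
Qed.

Lemma hit_iter n tau k l M ed j :
  iteri j (hit n tau k l M ed) 0 <= 1 /\
  (iteri j (hit n tau k l M ed) 0 = 1 <->
   exists2 i, i < j & good (scan M l ed n tau (start k (M - i).-1)) != 0).
Proof.
elim: j => [|j [IH1 IH2]]; first by split=> //; split=> // -[].
rewrite /= {1 3}/hit; case: eqP => Hg.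
  split=> //; rewrite IH2; split=> -[i Hi Hi']; exists i => //; first exact: ltnW.
  move: Hi; rewrite ltnS leq_eqVlt => /orP[/eqP Ei|//].
  by rewrite Ei Hg in Hi'.
by split=> //; split=> // _; exists j => //; apply/eqP.
Qed.

Lemma hitP n tau (E : nat -> {set {set 'I_n}}) k l : temporal_wf tau E ->
  (exists2 i, i < 2 ^ (n * k) &
     good (scan (2 ^ (n * k)) l (edge_at E) n tau (start k (2 ^ (n * k) - i).-1)) != 0) <->
  MinTimeline_inf tau E k l.
Proof.
move=> wf; rewrite MinTimeline_covering // -coverableP ?positions_sorted //.
split=> [[i Hi]|H].
  by rewrite scanE => /scan_coverable.
have Hall : all (fun p : pos => (p.1.2 < n) && (p.2 < n)) (positions n tau).
  by apply/allP => p; rewrite mem_positions => /and3P[_ -> ->].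
have HS : \sum_(i < n) k = n * k by rewrite sum_nat_const card_ord.
have [z Hz Hg] := coverable_scan Hall HS (leqnn _) H.
(* The round in which the countdown tries [z]. *)
exists (2 ^ (n * k) - z.+1); first by rewrite ltn_subrL expn_gt0.
by rewrite scanE subKn //= /start; move: Hg; rewrite subnn muln1 => ->.
Qed.

(* With [n = 0] or [tau = 0] only constant time is allowed, and the answer is yes. *)
Definition decider : cmd :=
  If rN (Block [:: IConst rN 1]) (If rTau (Block [:: IConst rN 1]) solver).

Theorem mainTheorem8 :
  exists (p : program) (c : nat),
    forall (n tau : nat) (E : nat -> {set {set 'I_n}}) (k l : nat),
      temporal_wf tau E ->
      exists s out,
        [/\ s <= c * (2 ^ (n * k) * n ^ 2 * tau) + c,
            halts_in p (encode tau E k l) s out,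
            out <= 1 &
            (out = 1 <-> MinTimeline_inf tau E k l)].
Proof.
exists (compile 0 decider), 1000 => n tau E k l wf.
pose Q (m : memory) := m 0 <= 1 /\ (m 0 = 1 <-> MinTimeline_inf tau E k l).
suff : hoare decider (encode tau E k l) (1000 * (2 ^ (n * k) * n ^ 2 * tau) + 1000) Q.
  move=> /(_ (compile 0 decider) 0) [//|s [m' [Hs Es [Q1 Q2]]]].
  exists s, (m' 0); split=> //.
  by rewrite /halts_in Es; split; first exact: halted_compile.
have triv : n = 0 \/ tau = 0 -> Q (foldl effect (encode tau E k l) [:: IConst rN 1]).
  by move=> H; split=> //; split=> // _; apply: MinTimeline_trivial.
(* The 5 leaves 2 steps for each of the two tests and 1 for a constant answer. *)
apply: (@hoare_le _ _ (1000 * (2 ^ (n * k) * n ^ 2 * tau) + 5)); last by rewrite leq_add2l.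
rewrite addnS addnS; apply: hoare_if => [n0|n0].
  apply: (@hoare_le _ _ 1); last by rewrite addnS.
  by apply: hoare_block => //; apply: triv; left.
rewrite addnS addnS; apply: hoare_if => [t0|t0].
  apply: (@hoare_le _ _ 1); last by rewrite addnS.
  by apply: hoare_block => //; apply: triv; right.
apply: hoare_le (leq_addr _ _).
apply: hoare_post (@solverP n tau k l (edge_at E) (encode tau E k l)
  erefl erefl erefl erefl _ _ n0 t0) => [m|x|t u v Ht Hu Hv].
- have [H1 H2] := hit_iter n tau k l (2 ^ (n * k)) (edge_at E) (2 ^ (n * k)).
  by move=> Em; rewrite /Q Em; split=> //; rewrite H2; apply: hitP.
- exact: encode_bit.
- exact: encode_edge.
Qed.
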